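(* For every $d\ge1$ there exists a constant $C_d>0$, depending only on $d$, such that the following holds. Let $n\ge1$, let $(X,Y),(X_1,Y_1),\dots,(X_n,Y_n)$ be independent and identically distributed with $X$ uniformly distributed on $[0,1]^d$, and suppose $g(x)=\mathbb E[Y\mid X=x]=\sum_{k=1}^d x_k$. Suppose the noise $\varepsilon=Y-g(X)$ satisfies $\mathbb E(\varepsilon\mid X)=0$ and $\mathbb E(\varepsilon^2\mid X)\ge\sigma^2_{\min}$, where $\sigma_{\min}^2\geq 0$ is a constant. Consider a local map $\mathcal V$ such that $\mathcal V(0)=\prod_{k=1}^d[0,h_k]$ for some deterministic side lengths $h_k\in(0,1]$. Let $\bar\gamma>0$ be such that $\mathrm{diam}(\mathcal V(0))^d/\lambda(\mathcal V(0))\ge\bar\gamma$. Whenever $2^{d+4}\log(2)\le n\prod_{k=1}^dh_k$, $$\mathbb E\left[(\hat g_{\mathcal V}(0)-g(0))^2\right]^{1/2}\ge C_d\left(\frac{\bar\gamma\,\sigma^2_{\min}}{n}\right)^{1/(d+2)}.$$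
   Context: A local map on $S_X=[0,1]^d$ is a mapping $\mathcal V$ from $S_X$ to the Borel subsets of $S_X$ with $x\in\mathcal V(x)$ for all $x$. The associated estimator is $\hat g_{\mathcal V}(x)=\sum_{i=1}^nY_i\mathbf 1_{\mathcal V(x)}(X_i)/\sum_{i=1}^n\mathbf 1_{\mathcal V(x)}(X_i)$, with the convention $0/0=0$. $\lambda$ is Lebesgue measure on $\mathbb R^d$ and $\mathrm{diam}(V)=\sup_{x,y\in V}\|x-y\|_2$ (Euclidean). *)

(* Defs.v *)
(* Library: MathComp and MathComp-Analysis. *)
From HB Require Import structures.
From mathcomp Require Import all_boot all_order all_algebra.
From mathcomp Require Import all_classical all_reals all_analysis.
From mathcomp Require Import measurable_realfun.

Set Implicit Arguments.
Unset Strict Implicit.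
Unset Printing Implicit Defensive.

Import Order.TTheory GRing.Theory Num.Theory.
Import numFieldNormedType.Exports.

Local Open Scope classical_set_scope.
Local Open Scope ring_scope.

(* Points of R^d are [d.-tuple R]; the sigma-algebra that the library puts on
   this type is generated by the coordinates, i.e. it is the Borel one. *)
Section Euclidean.
Context {R : realType}.

Definition origin (d : nat) : d.-tuple R := [tuple 0 | _ < d].

(* The closed box [0,h_1] x ... x [0,h_d]. *)
Definition box (d : nat) (h : 'I_d -> R) : set (d.-tuple R) :=
  [set x | forall k, 0 <= tnth x k <= h k].

Definition unit_cube (d : nat) : set (d.-tuple R) := box (fun=> 1).

Definition euclidean_dist (d : nat) (x y : d.-tuple R) : R :=
  Num.sqrt (\sum_(k < d) (tnth x k - tnth y k) ^+ 2).

(* The supremum is taken in R, hence is meaningful for nonempty bounded sets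
   only; local maps take their values in nonempty subsets of the cube. *)
Definition diam (d : nat) (V : set (d.-tuple R)) : R :=
  sup [set euclidean_dist x y | x in V & y in V].

(* Lebesgue measure on R^d, as the d-fold product of the Lebesgue measure on R:
   the measure of A is the integral of the measures of the slices of A obtained
   by fixing the first coordinate (this is what the product measure [\x] of the
   library unfolds to). It is used on measurable sets only. *)
Fixpoint lebesgue_tuple (d : nat) : set (d.-tuple R) -> \bar R :=
  match d return set (d.-tuple R) -> \bar R with
  | 0 => fun A => \d_ (origin 0) A
  | d'.+1 => fun A =>
      (\int[@lebesgue_measure R]_x
         @lebesgue_tuple d' [set t : d'.-tuple R | A [tuple of x :: t]])%E
  end.

End Euclidean.

Arguments origin {R} d.
Arguments unit_cube {R} d.

Section Probability.
Context {d0 : measure_display} {Omega : measurableType d0} {R : realType}.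
Variable P : probability Omega R.

Definition mutually_independent {d1 : measure_display} {T : measurableType d1}
    (I : finType) (Z : I -> Omega -> T) : Prop :=
  forall (J : {set I}) (B : I -> set T), (forall i, measurable (B i)) ->
    P [set w | forall i, i \in J -> B i (Z i w)] =
    (\prod_(i in J) P (Z i @^-1` B i))%E.

Definition identically_distributed {d1 : measure_display}
    {T : measurableType d1} (I : Type) (Z : I -> Omega -> T) : Prop :=
  forall (i j : I) (B : set T), measurable B ->
    P (Z i @^-1` B) = P (Z j @^-1` B).

(* lambda([0,1]^d) = 1, so no normalization is needed. *)
Definition uniform_on_cube (d : nat) (X : Omega -> d.-tuple R) : Prop :=
  forall B : set (d.-tuple R), measurable B ->
    P (X @^-1` B) = lebesgue_tuple (B `&` unit_cube d).

(* [f] is a version of the regression function x |-> E[Z | X = x], that is,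
   f(X) is a version of E[Z | X]. Both standard cases are covered: Z integrable,
   and Z nonnegative (in which case f may take the value +oo). In the first
   case the last clause forces f(X) to be integrable, and in the second case it
   forces f(X) to be nonnegative almost surely. *)
Definition is_cond_expectation {d1 : measure_display} {T : measurableType d1}
    (X : Omega -> T) (Z : Omega -> \bar R) (f : T -> \bar R) : Prop :=
  [/\ P.-integrable setT Z \/
        (measurable_fun setT Z /\ forall w, (0 <= Z w)%E),
      measurable_fun setT f &
      forall B : set T, measurable B ->
        (\int[P]_(w in X @^-1` B) Z w = \int[P]_(w in X @^-1` B) f (X w))%E].

End Probability.

Section LocalMaps.
Context {R : realType}.

(* Only the values of V on the cube matter. *)
Definition is_local_map (d : nat)
    (V : d.-tuple R -> set (d.-tuple R)) : Prop :=
  forall x, unit_cube d x ->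
    [/\ measurable (V x), V x `<=` unit_cube d & V x x].

(* The convention 0/0 = 0 is automatic, since 0^-1 = 0 in a field. *)
Definition local_estimator {Omega : Type} (d n : nat)
    (V : d.-tuple R -> set (d.-tuple R))
    (Xs : 'I_n -> Omega -> d.-tuple R) (Ys : 'I_n -> Omega -> R)
    (x : d.-tuple R) (w : Omega) : R :=
  (\sum_(i < n) Ys i w * \1_(V x) (Xs i w)) /
  (\sum_(i < n) \1_(V x) (Xs i w)).

Definition coord_sum (d : nat) (x : d.-tuple R) : R := \sum_(k < d) tnth x k.

(* The generic pair (X, Y), at index [None], together with the sample
   (X_i, Y_i), at the indices [Some i]. *)
Definition pairs {Omega : Type} (d n : nat)
    (X : Omega -> d.-tuple R) (Y : Omega -> R)
    (Xs : 'I_n -> Omega -> d.-tuple R) (Ys : 'I_n -> Omega -> R)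
    (o : option 'I_n) (w : Omega) : d.-tuple R * R :=
  if o is Some i then (Xs i w, Ys i w) else (X w, Y w).

End LocalMaps.

(* Main.v *)
Require Import Defs.
From mathcomp Require Import all_boot all_order all_algebra.
From mathcomp Require Import all_classical all_reals all_analysis.
From mathcomp Require Import measurable_realfun.
From mathcomp Require Import ring lra.

(* Let N be the number of design points falling in the box V(0), let p be the
   volume of the box and let s = h_1 + ... + h_d. On the event that the points
   in the box are exactly those indexed by J, of probability
   p^|J| (1-p)^(n-|J|), the estimator is an average of |J| independent copies of
   Y given X in V(0). If m is the mean of this conditional law and t is a lower
   bound on its second moment, the quadratic risk is at least
     E[(t/N + (1 - 1/N) m^2) 1(N > 0)],
   hence at least m^2 P(N > 0) >= m^2/2 (bias) and
   t E[1(N > 0)/N] >= t/(4np) (variance). Since X is uniform, m >= s/4, and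
   one can take t = max(m^2, sigma^2/2 - s^2), so the risk dominates both s^2
   and sigma^2/(np), up to constants. Finally gamma <= s^d/p, which gives
   gamma sigma^2/n <= s^d sigma^2/(np) <= const * risk^((d+2)/2). *)

Set Implicit Arguments.
Unset Strict Implicit.
Unset Printing Implicit Defensive.

Import Order.TTheory GRing.Theory Num.Theory.
Import numFieldNormedType.Exports.

Local Open Scope classical_set_scope.
Local Open Scope ring_scope.

(** * Integrals of products of functions of independent variables *)

Section Independence.
Context {d0 d1 : measure_display} {Omega : measurableType d0}
  {T : measurableType d1} {R : realType}.

Import HBNNSimple.

Lemma integral_comp_approx (mu : {measure set Omega -> \bar R})
    (Z : Omega -> T) (g : Omega -> \bar R) (f : T -> R)
    (mf : measurable_fun setT (EFin \o f)) :
  measurable_fun setT Z -> measurable_fun setT g -> (forall w, 0 <= g w)%E ->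
  (forall z, 0 <= f z) ->
  (\int[mu]_w (g w * (f (Z w))%:E) =
   limn (fun n => let phi := nnsfun_approx measurableT mf n in
     \sum_(y \in range phi)
       (y%:E * \int[mu]_(w in Z @^-1` (phi @^-1` [set y])) g w)))%E.
Proof.
move=> mZ mg g0 f0.
set phi := nnsfun_approx measurableT mf.
have mphi n : measurable_fun setT (fun w => (phi n (Z w))%:E).
  apply/measurable_EFinP; apply: (measurableT_comp _ mZ); exact: measurable_funP.
have phi0 n z : (0 <= (phi n z)%:E)%E by rewrite lee_fin.
have phiC z : (phi n z)%:E @[n --> \oo] --> (f z)%:E.
  by apply: (cvg_nnsfun_approx measurableT mf) => // ? _; rewrite /= lee_fin.
have phiM z m n : (m <= n)%N -> ((phi m z)%:E <= (phi n z)%:E)%E.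
  by move=> mn; rewrite lee_fin; exact/lefP/nd_nnsfun_approx.
transitivity (limn (fun n => \int[mu]_w (g w * (phi n (Z w))%:E))%E).
  rewrite -monotone_convergence //.
  - apply: eq_integral => w _; apply/esym/cvg_lim => //.
    (* Since [g w] may be [+oo], the product of limits could be the indeterminate form [+oo * 0].
       When [f (Z w) = 0], the approximations from below vanish as well, so the sequence is
       constant. *)
    have [f00|fN0] := eqVneq (f (Z w)) 0.
      have phi00 n : phi n (Z w) = 0.
        apply/eqP; rewrite eq_le -lee_fin -[X in _ && X]lee_fin phi0 andbT -f00.
        have /cvg_lim := ereal_nondecreasing_cvgn (fun a b => @phiM (Z w) a b).
        rewrite (cvg_lim _ (phiC (Z w)))// => ->//.
        by apply: ereal_sup_ubound; exists n.
      rewrite f00; under eq_fun do rewrite phi00; exact: cvg_cst.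
    apply: cvgeM (phiC _); last exact: cvg_cst.
    have {fN0} : (f (Z w))%:E != 0%E by [].
    by rewrite /mule_def => ->; rewrite ?andbF ?orbT; case: (g w).
  - by move=> n; exact: emeasurable_funM.
  - by move=> n w _; rewrite mule_ge0.
  - by move=> w _ m n mn; apply: lee_wpmul2l => //; exact: phiM.
congr (limn _); apply/funext => n /=; rewrite -/phi.
have mZphi y : measurable (Z @^-1` (phi n @^-1` [set y])).
  by rewrite -[X in measurable X]setTI; apply: mZ => //; exact: measurable_funPTI.
transitivity (\int[mu]_w \sum_(y \in range (phi n))
    (g w * (y * \1_(Z @^-1` (phi n @^-1` [set y])) w)%:E))%E.
  apply: eq_integral => w _; rewrite fimfunE -fsumEFin// ge0_mule_fsumr//.
  by move=> y; exact: nnfun_muleindic_ge0.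
rewrite ge0_integral_fsum//; last 2 first.
- move=> y; apply: emeasurable_funM => //; apply/measurable_EFinP.
  by apply: measurable_funM => //; exact: measurable_indic.
- by move=> y w _; rewrite mule_ge0// (nnfun_muleindic_ge0 (phi n) y (Z w)).
apply: eq_fsbigr => y /[!inE] -[z _ zy].
rewrite [in RHS]integral_mkcond epatch_indic -ge0_integralZl//=.
- by apply: eq_integral => w _; rewrite EFinM muleCA.
- by apply: emeasurable_funM => //; apply/measurable_EFinP; exact: measurable_indic.
- by move=> w _; rewrite mule_ge0// lee_fin.
- by rewrite lee_fin -zy.
Qed.

(** By [integral_comp_approx], both sides are limits of the same sequence. This is what upgrades one
    indicator to an arbitrary nonnegative function in the induction below. *)
Lemma eq_integral_comp (mu : {measure set Omega -> \bar R})
    (Z Z' : Omega -> T) (g g' : Omega -> \bar R) (f : T -> R) :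
  measurable_fun setT Z -> measurable_fun setT Z' ->
  measurable_fun setT g -> measurable_fun setT g' ->
  (forall w, 0 <= g w)%E -> (forall w, 0 <= g' w)%E ->
  (forall B, measurable B ->
    \int[mu]_(w in Z @^-1` B) g w = \int[mu]_(w in Z' @^-1` B) g' w)%E ->
  measurable_fun setT f -> (forall z, 0 <= f z) ->
  (\int[mu]_w (g w * (f (Z w))%:E) = \int[mu]_w (g' w * (f (Z' w))%:E))%E.
Proof.
move=> mZ mZ' mg mg' g0 g'0 gg' mf f0.
have mfE : measurable_fun setT (EFin \o f) by exact/measurable_EFinP.
rewrite !(integral_comp_approx mu mfE)//; congr (limn _); apply/funext => n.
apply: eq_fsbigr => y _; rewrite gg'//.
Qed.

Context {P : probability Omega R} {I : finType}.
Variables (Z : I -> Omega -> T) (W : Omega -> T).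
Hypothesis mZ : forall i, measurable_fun setT (Z i).
Hypothesis mW : measurable_fun setT W.
Hypothesis indepZ : forall D : I -> set T, (forall i, measurable (D i)) ->
  P [set w | forall i, D i (Z i w)] = (\prod_i P (W @^-1` D i))%E.

Let mpre (U : Omega -> T) (mU : measurable_fun setT U) B :
  measurable B -> measurable (U @^-1` B).
Proof. by move=> mB; rewrite -[X in measurable X]setTI; exact: mU. Qed.

(* Independence of events is the case where all [f i] are indicators; the induction
   replaces one indicator at a time by an arbitrary function, [s] listing the
   indices already treated. *)
Lemma ge0_integral_prod_indic (s : seq I) (f : I -> T -> R) :
  (forall i, measurable_fun setT (f i)) -> (forall i z, 0 <= f i z) ->
  (forall i, i \notin s -> exists2 D, measurable D & f i = \1_D) ->
  (\int[P]_w (\prod_i f i (Z i w))%:E = \prod_i \int[P]_w (f i (W w))%:E)%E.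
Proof.
elim: s f => [|i s IHs] f mf f0 fI.
  have /choice [D DP] i : exists D, measurable D /\ f i = \1_D.
    by have [|D] := fI i; [|exists D].
  have mD i : measurable (D i) by case: (DP i).
  have fD i : f i = \1_(D i) by case: (DP i).
  have mDZ : measurable [set w | forall i, D i (Z i w)].
    rewrite (_ : mkset _ = \bigcap_(i in setT) (Z i @^-1` D i)); last first.
      by apply/seteqP; split=> w /= Dw; [move=> i _; exact: Dw | move=> i; exact: Dw].
    by apply: fin_bigcap_measurable => // i _; exact: mpre.
  transitivity (P [set w | forall i, D i (Z i w)]).
    rewrite -[in RHS](setIT (mkset _)) -integral_indic//.
    apply: eq_integral => w _; congr EFin.
    rewrite [in RHS]indicE; have [/set_mem /= Dw|/negP nDw] := boolP (w \in _).
      by rewrite big1// => i _; rewrite fD indicE mem_set.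
    have [i Di] : exists i, ~ D i (Z i w).
      by apply/existsNP => Dw; apply/nDw/mem_set.
    by rewrite (bigD1 i)//= fD indicE memNset// mul0r.
  rewrite indepZ//; apply: eq_bigr => i _; rewrite fD.
  by rewrite (integral_indic _ measurableT (mpre mW (mD i))) setIT.
(* The factor of index [i] is isolated. The rest [g] will be replaced by its expected mean [c], and
   [Z i] by [W]. *)
pose g w := (\prod_(k | k != i) f k (Z k w))%:E.
have f0P (Q : pred I) (x : I -> T) : 0 <= \prod_(k | Q k) f k (x k).
  by apply: prodr_ge0 => k _; exact: f0.
have mfZ k : measurable_fun setT (fun w => f k (Z k w)).
  exact: (measurableT_comp (mf k) (mZ k)).
have mg : measurable_fun setT g.
  apply/measurable_EFinP.
  under eq_fun do rewrite big_mkcond; apply: measurable_prod => k _.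
  by case: (k != i).
pose c := (\prod_(k | k != i) \int[P]_w (f k (W w))%:E)%E.
have c0 : (0 <= c)%E.
  by apply: prode_ge0 => k _; apply: integral_ge0 => w _; rewrite lee_fin.
transitivity (\int[P]_w (g w * (f i (Z i w))%:E))%E.
  by apply: eq_integral => w _; rewrite (bigD1 i)//= EFinM muleC.
have mfW : measurable_fun setT (fun w => (f i (W w))%:E).
  by apply/measurable_EFinP; exact: (measurableT_comp (mf i) mW).
transitivity (\int[P]_w (c * (f i (W w))%:E))%E; last first.
  rewrite (ge0_integralZl P measurableT mfW _ c0); last first.
    by move=> w _; rewrite lee_fin.
  by rewrite [RHS](bigD1 i)//= muleC.
apply: (@eq_integral_comp P (Z i) W g (fun=> c)) => //.
  by move=> w; rewrite lee_fin.
move=> B mB.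
(* By [eq_integral_comp], testing on sets [B] suffices. This puts an indicator at index [i], which
   therefore need not be in the list: the induction hypothesis for [s] applies. *)
pose fB k := if k == i then \1_B else f k.
have fBi : fB i = \1_B by rewrite /fB eqxx.
have fBN k : k != i -> fB k = f k by rewrite /fB => /negbTE ->.
have mB_ (U : Omega -> T) : measurable_fun setT U -> measurable (U @^-1` B).
  by move=> mU; exact: mpre.
transitivity (\int[P]_w (\prod_k fB k (Z k w))%:E)%E.
  rewrite integral_mkcond epatch_indic; apply: eq_integral => w _.
  rewrite [in RHS](bigD1 i)//= fBi EFinM muleC; congr (_ * _%:E)%E.
  by apply: eq_bigr => k /fBN ->.
rewrite IHs; last 3 first.
- by move=> k; have [->|/fBN ->//] := eqVneq k i; rewrite fBi; exact: measurable_indic.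
- by move=> k z; have [->|/fBN ->//] := eqVneq k i; rewrite fBi.
- move=> k ks; have [->|ki] := eqVneq k i; first by exists B.
  by rewrite fBN//; apply: fI; rewrite inE negb_or ki.
rewrite (bigD1 i)//= fBi [X in (X * _)%E](_ : _ = P (W @^-1` B)); last first.
  by rewrite (integral_indic _ measurableT (mB_ _ mW)) setIT.
rewrite (eq_bigr (fun k => \int[P]_w (f k (W w))%:E)%E); last first.
  by move=> k /fBN ->.
by rewrite -/c muleC -(integral_cst P (mB_ _ mW) c).
Qed.

Lemma ge0_integral_prod (f : I -> T -> R) :
  (forall i, measurable_fun setT (f i)) -> (forall i z, 0 <= f i z) ->
  (\int[P]_w (\prod_i f i (Z i w))%:E = \prod_i \int[P]_w (f i (W w))%:E)%E.
Proof.
move=> mf f0; apply: (ge0_integral_prod_indic (s := index_enum I)) => // i.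
by rewrite mem_index_enum.
Qed.

(** The nonnegative case, applied to absolute values, gives a finite product of finite integrals. *)
Lemma integrable_prod (f : I -> T -> R) :
  (forall i, measurable_fun setT (f i)) ->
  (forall i, P.-integrable setT (fun w => (f i (W w))%:E)) ->
  P.-integrable setT (fun w => (\prod_i f i (Z i w))%:E).
Proof.
move=> mf fint; apply/integrableP; split.
  apply/measurable_EFinP; apply: measurable_prod => i _.
  exact: (measurableT_comp (mf i) (mZ i)).
under eq_integral do rewrite abse_EFin normr_prod.
rewrite (ge0_integral_prod (f := fun i z => `|f i z|)) => [|i|//]; last first.
  exact: measurableT_comp.
rewrite ltey_eq prode_fin_num// => i _.
by apply: integrable_fin_num => //; exact: integrable_abse (fint i).
Qed.

(** Each factor is split into positive and negative parts and the product is expanded over the sets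
    [J] of indices where the positive part is chosen. Every term is then a signed product of
    nonnegative integrable functions. *)
Lemma integral_prod (f : I -> T -> R) :
  (forall i, measurable_fun setT (f i)) ->
  (forall i, P.-integrable setT (fun w => (f i (W w))%:E)) ->
  (\int[P]_w (\prod_i f i (Z i w))%:E =
   \prod_i \int[P]_w (f i (W w))%:E)%E.
Proof.
move=> mf fint.
pose g (J : {set I}) i := if i \in J then (f i)^\+ else (f i)^\-.
pose e (J : {set I}) := \prod_(i : I) (if i \in J then 1 else -1 : R).
have mg J i : measurable_fun setT (g J i).
  by rewrite /g; case: ifP => _;
    [exact: measurable_funrpos|exact: measurable_funrneg].
have g0 J i z : 0 <= g J i z by rewrite /g; case: ifP.
have gint J i : P.-integrable setT (fun w => (g J i (W w))%:E).
  by rewrite /g; case: ifP => _;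
    [exact: (integrable_funrpos measurableT (fint i))
    |exact: (integrable_funrneg measurableT (fint i))].
have expand (x y : I -> R) : \prod_i (x i - y i) =
    \sum_(J : {set I}) e J * \prod_i (if i \in J then x i else y i).
  rewrite bigA_distr; apply: eq_bigr => J _; rewrite -big_split/=.
  by apply: eq_bigr => i _; case: ifP; rewrite ?mul1r// mulN1r.
have fE i z : f i z = (f i)^\+ z - (f i)^\- z by rewrite -[in LHS](funrposBneg (f i)).
pose p i := fine (\int[P]_w ((f i)^\+ (W w))%:E).
pose n i := fine (\int[P]_w ((f i)^\- (W w))%:E).
have fin_int h : P.-integrable setT (fun w => (h (W w))%:E) ->
    (fine (\int[P]_w (h (W w))%:E))%:E = (\int[P]_w (h (W w))%:E)%E.
  by move=> hint; rewrite fineK//; exact: integrable_fin_num.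
have pE i : (p i)%:E = (\int[P]_w ((f i)^\+ (W w))%:E)%E.
  by apply: fin_int; exact: (integrable_funrpos measurableT (fint i)).
have nE i : (n i)%:E = (\int[P]_w ((f i)^\- (W w))%:E)%E.
  by apply: fin_int; exact: (integrable_funrneg measurableT (fint i)).
transitivity (\prod_i (p i - n i))%:E; last first.
  rewrite -prodEFin; apply: eq_bigr => i _.
  rewrite EFinB pE nE -integralB//; last 2 first.
  - exact: (integrable_funrpos measurableT (fint i)).
  - exact: (integrable_funrneg measurableT (fint i)).
  by apply: eq_integral => w _; rewrite fE EFinB.
transitivity (\int[P]_w \sum_(J : {set I}) (e J * \prod_i g J i (Z i w))%:E)%E.
  apply: eq_integral => w _; rewrite sumEFin; congr EFin.
  under eq_bigr do rewrite fE.
  rewrite expand; apply: eq_bigr => J _; congr (_ * _).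
  by apply: eq_bigr => i _; rewrite /g; case: ifP.
rewrite integral_sum//; last first.
  move=> J.
  exact: (integrableZl measurableT (e J) (integrable_prod (mg J) (gint J))).
rewrite expand -sumEFin; apply: eq_bigr => J _.
under eq_integral do rewrite EFinM.
rewrite integralZl ?ge0_integral_prod//; last exact: integrable_prod.
rewrite EFinM -[X in _ = (_ * X)%E]prodEFin; congr (_ * _)%E; apply: eq_bigr => i _.
by rewrite /g; case: ifP => _; rewrite ?pE ?nE.
Qed.

End Independence.

(** Here [f] may have infinite integral, as squares of [Y] do below. If the integral of [f + c] is
    [+oo] there is nothing to prove; otherwise [f = (f + c) - c] is integrable and additivity
    applies. *)
Lemma ge0_integralD_integrable {d0 : measure_display} {Omega : measurableType d0}
    {R : realType} (mu : {measure set Omega -> \bar R}) (f c : Omega -> R) :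
  measurable_fun setT f -> (forall w, 0 <= f w) ->
  mu.-integrable setT (EFin \o c) -> (forall w, 0 <= f w + c w) ->
  (\int[mu]_w (f w)%:E + \int[mu]_w (c w)%:E <= \int[mu]_w (f w + c w)%:E)%E.
Proof.
move=> mf f0 cint fc0.
have mc : measurable_fun setT c by exact/measurable_EFinP/(measurable_int mu).
have [->|] := eqVneq (\int[mu]_w (f w + c w)%:E)%E +oo%E; first exact: leey.
rewrite -ltey => fcfin.
have fcint : mu.-integrable setT (EFin \o (fun w => f w + c w)).
  apply/integrableP; split; first exact/measurable_EFinP/measurable_funD.
  by under eq_integral do rewrite /= ger0_norm//.
have fint : mu.-integrable setT (EFin \o f).
  have := integrableB measurableT fcint cint.
  by apply: eq_integrable => // w _; rewrite /= -EFinB addrK.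
by rewrite -integralD//; under eq_integral do rewrite -EFinD.
Qed.

Lemma lee_prod {R : realDomainType} {I : finType} (a b : I -> \bar R) :
  (forall i, 0 <= a i)%E -> (forall i, a i <= b i)%E ->
  (\prod_i a i <= \prod_i b i)%E.
Proof.
move=> a0 ab.
suff: (0 <= \prod_i a i <= \prod_i b i)%E by move=> /andP[].
elim/big_rec2 : _ => [|i x y _ /andP[x0 xy]]; first by rewrite lee01 lexx.
by rewrite mule_ge0// lee_pmul.
Qed.

(** * Lower bound on the second moment of a local average *)

Section LocalAverage.
Context {d0 d1 : measure_display} {Omega : measurableType d0}
  {T : measurableType d1} {R : realType} {P : probability Omega R} {I : finType}.
Variables (Z : I -> Omega -> T) (W : Omega -> T).
Hypothesis mZ : forall i, measurable_fun setT (Z i).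
Hypothesis mW : measurable_fun setT W.
Hypothesis indepZ : forall D : I -> set T, (forall i, measurable (D i)) ->
  P [set w | forall i, D i (Z i w)] = (\prod_i P (W @^-1` D i))%E.
Variables (B : set T) (y : T -> R) (p m t : R).
Hypothesis mB : measurable B.
Hypothesis my : measurable_fun setT y.
Hypothesis pE : P (W @^-1` B) = p%:E.
Hypothesis yint : P.-integrable setT (fun w => (\1_B (W w) * y (W w))%:E).
Hypothesis mE : (\int[P]_w (\1_B (W w) * y (W w))%:E)%E = (p * m)%:E.
Hypothesis t0 : 0 <= t.
Hypothesis tE : ((p * t)%:E <= \int[P]_w (\1_B (W w) * y (W w) ^+ 2)%:E)%E.

(** The product over [k] of [u J k (Z k w)] indicates the event that the points in [B] are exactly
    those indexed by [J], and [q J k] is the mean of its factor [k]. The functions [phi J i j]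
    insert the values of [y] at [i] and [j], hence a square when [i = j], while keeping the product
    form that independence requires. *)
Let u (J : {set I}) i (z : T) : R := if i \in J then \1_B z else \1_(~` B) z.
Let q (J : {set I}) i := if i \in J then p else 1 - p.
Let phi (J : {set I}) i j k (z : T) :=
  u J k z * (if k == i then y z else 1) * (if k == j then y z else 1).

Let measurable_u (J : {set I}) i : measurable_fun setT (u J i).
Proof.
by rewrite /u; case: (i \in J); apply: measurable_indic => //; exact: measurableC.
Qed.

Let mphi J i j k : measurable_fun setT (phi J i j k).
Proof.
have myl l : measurable_fun setT (fun z => if k == l then y z else 1).
  by case: (k == l).
exact: measurable_funM (measurable_funM (measurable_u J k) (myl i)) (myl j).
Qed.

Let u0 J i z : 0 <= u J i z. Proof. by rewrite /u; case: ifP. Qed.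

Let uint J i : P.-integrable setT (fun w => (u J i (W w))%:E).
Proof.
apply: (le_integrable measurableT (g := cst 1%E)) => //.
- by apply/measurable_EFinP; exact: (measurableT_comp (measurable_u J i) mW).
- move=> w _ /=; rewrite lee_fin !ger0_norm// /u.
  by case: ifP => _; rewrite indicE; case: (_ \in _).
- exact: finite_measure_integrable_cst.
Qed.

Let u_int J i : (\int[P]_w (u J i (W w))%:E)%E = (q J i)%:E.
Proof.
have mWB D : measurable D -> measurable (W @^-1` D).
  by move=> mD; rewrite -[X in measurable X]setTI; exact: mW.
have EB D : measurable D ->
    (\int[P]_w (\1_D (W w))%:E)%E = P (W @^-1` D).
  by move=> mD; rewrite (integral_indic _ measurableT (mWB _ mD)) setIT.
rewrite /u /q; case: ifP => _; rewrite EB//; last exact: measurableC.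
by rewrite preimage_setC probability_setC ?pE//; exact: mWB.
Qed.

Let prod_phi J i j (w : Omega) : \prod_k phi J i j k (Z k w) =
  (\prod_k u J k (Z k w)) * (y (Z i w) * y (Z j w)).
Proof.
by rewrite /phi !big_split/= -!big_mkcond/= !big_pred1_eq mulrA.
Qed.

(** For distinct [i] and [j], only first moments of [y] on [B] occur: these two factors have mean
    [p * m], every other factor [k] has mean [q J k]. *)
Let offdiag (J : {set I}) i j : i \in J -> j \in J -> i != j ->
  P.-integrable setT (fun w => (\prod_k phi J i j k (Z k w))%:E) /\
  (\int[P]_w (\prod_k phi J i j k (Z k w))%:E = (\prod_k q J k * m ^+ 2)%:E)%E.
Proof.
move=> iJ jJ ij.
have phiE k : phi J i j k = if (k == i) || (k == j) then (fun z => \1_B z * y z)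
                            else u J k.
  apply/funext => z; rewrite /phi; have [->|ki] := eqVneq k i.
    by rewrite (negbTE ij) mulr1 /u iJ.
  rewrite mulr1; have [->|kj] := eqVneq k j; first by rewrite /u jJ.
  by rewrite mulr1.
have phint k : P.-integrable setT (fun w => (phi J i j k (W w))%:E).
  by rewrite phiE; case: ifP.
split; first exact: (integrable_prod mZ mW indepZ).
rewrite (integral_prod mZ mW indepZ)//.
transitivity (\prod_k (q J k * (if k == i then m else 1)
                             * (if k == j then m else 1)))%:E; last first.
  by rewrite !big_split/= -!big_mkcond/= !big_pred1_eq mulrA.
rewrite -prodEFin; apply: eq_bigr => k _; rewrite phiE.
have [->|ki] := eqVneq k i; first by rewrite (negbTE ij) mulr1 mE /q iJ.
rewrite mulr1; have [->|kj] := eqVneq k j; first by rewrite mE /q jJ.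
by rewrite mulr1 u_int.
Qed.

(** The factor [i] now carries the square of [y], whose integral is bounded below by [p * t] but may
    be infinite. All factors are nonnegative, so the product formula holds without integrability. *)
Let diag (J : {set I}) i : i \in J ->
  ((\prod_k q J k * t)%:E <= \int[P]_w (\prod_k phi J i i k (Z k w))%:E)%E.
Proof.
move=> iJ.
have phiE k : phi J i i k = if k == i then (fun z => \1_B z * y z ^+ 2)
                            else u J k.
  apply/funext => z; rewrite /phi; have [->|ki] := eqVneq k i.
    by rewrite /u iJ mulrA.
  by rewrite !mulr1.
have q0 k : 0 <= q J k by rewrite -lee_fin -u_int; apply: integral_ge0 => w _; rewrite lee_fin.
rewrite (ge0_integral_prod mZ mW indepZ)//; last first.
  by move=> k z; rewrite phiE; case: ifP => // _; rewrite mulr_ge0// sqr_ge0.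
rewrite (_ : _ * t = \prod_k (q J k * (if k == i then t else 1))); last first.
  by rewrite big_split/= -big_mkcond/= big_pred1_eq.
rewrite -prodEFin; apply: lee_prod => k; first by rewrite lee_fin mulr_ge0//; case: ifP.
rewrite phiE; have [->|ki] := eqVneq k i; first by rewrite /q iJ.
by rewrite mulr1 u_int.
Qed.

Let prod_u_sum (w : Omega) : \sum_(J : {set I}) \prod_k u J k (Z k w) = 1.
Proof.
rewrite -(@bigA_distr _ _ 1 _ _ _ (fun k => \1_B (Z k w)) (fun k => \1_(~` B) (Z k w))).
rewrite big1// => k _; rewrite !indicE in_setC.
by case: (_ \in _) => /=; rewrite ?addr0 ?add0r.
Qed.

Let est w := (\sum_i y (Z i w) * \1_B (Z i w)) / \sum_i \1_B (Z i w).

Let S (J : {set I}) w := \sum_(i in J) y (Z i w).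

(* Only the term where [J] indexes the points of [B] is nonzero. *)
Let est_split w : est w ^+ 2 =
  \sum_(J : {set I}) (#|J|%:R ^- 2 * (\prod_k u J k (Z k w) * S J w ^+ 2)).
Proof.
transitivity (\sum_(J : {set I}) (\prod_k u J k (Z k w)) * est w ^+ 2).
  by rewrite -mulr_suml prod_u_sum mul1r.
apply: eq_bigr => J _.
have [/existsP [k /eqP uk0]|] := boolP [exists k, u J k (Z k w) == 0].
  rewrite (bigD1 k)//= uk0. by rewrite !mul0r mulr0.
rewrite negb_exists => /forallP un0.
have BJ k : \1_B (Z k w) = (k \in J)%:R :> R.
  have := un0 k; rewrite /u; case: ifP => kJ; rewrite !indicE ?in_setC;
    by case: (_ \in _) => //=; rewrite eqxx.
rewrite [RHS]mulrCA; congr (_ * _); rewrite /est expr_div_n mulrC.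
congr (_ ^- 2 * _ ^+ 2).
  rewrite -sum1_card natr_sum [RHS]big_mkcond/=.
  by apply: eq_bigr => k _; rewrite BJ; case: (_ \in _).
rewrite /S [RHS]big_mkcond/=; apply: eq_bigr => k _.
by rewrite BJ; case: (_ \in _); rewrite ?mulr1 ?mulr0.
Qed.

Let mZf (f : T -> R) k : measurable_fun setT f ->
  measurable_fun setT (fun w => f (Z k w)).
Proof. by move=> mf; exact: measurableT_comp mf (mZ k). Qed.

(** Expanding the square of [S J] gives [#|J|] diagonal terms, each at least [t] times the
    probability of the event, and [#|J| * #|J|.-1] off-diagonal terms, each equal to [m ^+ 2] times
    it. The diagonal part [f] may fail to be integrable, the off-diagonal part [c] is integrable,
    and their sum is nonnegative. *)
Let lower_J (J : {set I}) :
  ((\prod_k q J k * (#|J|%:R * t + (#|J| * #|J|.-1)%:R * m ^+ 2))%:E <=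
   \int[P]_w (\prod_k u J k (Z k w) * S J w ^+ 2)%:E)%E.
Proof.
set a := \prod_k q J k.
pose f w := \sum_(i in J) \prod_k phi J i i k (Z k w).
pose g i j w := if [&& i \in J, j \in J & j != i] then
  \prod_k phi J i j k (Z k w) else 0.
pose c w := \sum_i \sum_j g i j w.
have mphiZ i j : measurable_fun setT (fun w => \prod_k phi J i j k (Z k w)).
  by apply: measurable_prod => k _; exact: mZf.
have phii0 i w : 0 <= \prod_k phi J i i k (Z k w).
  by rewrite prod_phi mulr_ge0// ?prodr_ge0// -expr2 sqr_ge0.
have fcE w : \prod_k u J k (Z k w) * S J w ^+ 2 = f w + c w.
  transitivity (\sum_i ((if i \in J then \prod_k phi J i i k (Z k w) else 0) +
                        \sum_j g i j w)); last by rewrite big_split/= -big_mkcond.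
  rewrite expr2 {1}/S mulr_suml mulr_sumr [LHS]big_mkcond/=; apply: eq_bigr => i _; rewrite /g.
  case: ifP => iJ /=; last by rewrite big1// addr0.
  rewrite -big_mkcond/= mulr_sumr mulr_sumr (bigD1 i)//= -prod_phi.
  by congr (_ + _); apply: eq_bigr => j _; rewrite -prod_phi.
have gint i j : P.-integrable setT (EFin \o g i j).
  rewrite /g /comp; have [/and3P[iJ jJ ji]|_] := boolP [&& _, _ & _];
    last exact: integrable0.
  by rewrite eq_sym in ji; case: (offdiag iJ jJ ji).
have g_int i j : (\int[P]_w (g i j w)%:E)%E =
    (if [&& i \in J, j \in J & j != i] then a * m ^+ 2 else 0)%:E.
  rewrite /g; have [/and3P[iJ jJ ji]|_] := boolP [&& _, _ & _];
    last by rewrite integral0.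
  by rewrite eq_sym in ji; case: (offdiag iJ jJ ji).
have gintS i : P.-integrable setT (fun w => (\sum_j g i j w)%:E).
  under eq_fun do rewrite -sumEFin.
  by apply: integrable_sum => // j _; exact: gint.
have intc : P.-integrable setT (EFin \o c).
  rewrite /comp /c; under eq_fun do rewrite -sumEFin.
  by apply: integrable_sum => // i _; exact: gintS.
under eq_integral do rewrite fcE.
have mf : measurable_fun setT f.
  rewrite /f; under eq_fun do rewrite big_mkcond.
  by apply: measurable_sum => i; case: (i \in J).
apply: le_trans (ge0_integralD_integrable mf _ intc _); last 2 first.
- by move=> w; apply: sumr_ge0.
- by move=> w; rewrite -fcE mulr_ge0 ?sqr_ge0 ?prodr_ge0.
rewrite mulrDr EFinD; apply: leeD.
  rewrite /f; under eq_integral do rewrite -big_enum -sumEFin.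
  rewrite ge0_integral_sum//; last 2 first.
  - by move=> i; exact/measurable_EFinP.
  - by move=> i w _; rewrite lee_fin.
  rewrite big_enum/= mulrA mulrAC mulr_natr -sumr_const -sumEFin.
  by apply: lee_sum => i; exact: diag.
rewrite /c; under eq_integral do rewrite -sumEFin.
rewrite integral_sum//.
rewrite (eq_bigr (fun i => (\sum_(j : I)
  (if [&& i \in J, j \in J & j != i] then a * m ^+ 2 else 0))%:E)); last first.
  move=> i _; under eq_integral do rewrite -sumEFin.
  by rewrite integral_sum//; [rewrite -sumEFin; apply: eq_bigr|exact: gint].
rewrite sumEFin lee_fin le_eqVlt; apply/orP; left; apply/eqP.
rewrite (eq_bigr (fun i => if i \in J then a * m ^+ 2 *+ #|J|.-1 else 0)).
  rewrite -big_mkcond/= sumr_const -mulrnA mulnC -[RHS]mulr_natr.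
  by rewrite mulrCA [RHS]mulrC.
move=> i _; case: ifP => iJ /=; last by rewrite big1.
rewrite -big_mkcond/=; under eq_bigl do rewrite andbC -in_setD1.
by rewrite sumr_const (cardsD1 i J) iJ.
Qed.

Lemma local_average_lower_bound :
  ((\sum_(J : {set I}) #|J|%:R ^- 2 * (\prod_(k : I) (if k \in J then p else 1 - p) *
      (#|J|%:R * t + (#|J| * #|J|.-1)%:R * m ^+ 2)))%:E <=
   \int[P]_w (((\sum_i y (Z i w) * \1_B (Z i w)) / \sum_i \1_B (Z i w)) ^+ 2)%:E)%E.
Proof.
under eq_integral do rewrite -/(est _) est_split -sumEFin.
have mu2 J : measurable_fun setT (fun w => \prod_k u J k (Z k w) * S J w ^+ 2).
  apply: measurable_funM; first by apply: measurable_prod => k _; exact: mZf.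
  apply: measurable_funX; rewrite /S; under eq_fun do rewrite big_mkcond.
  by apply: measurable_sum => i; case: (i \in J) => //; exact: mZf.
have u20 J w : 0 <= \prod_k u J k (Z k w) * S J w ^+ 2.
  by rewrite mulr_ge0 ?sqr_ge0 ?prodr_ge0.
rewrite ge0_integral_sum//; last 2 first.
- by move=> J; apply/measurable_EFinP; exact: measurable_funM.
- by move=> J w _; rewrite lee_fin mulr_ge0// invr_ge0 exprn_ge0.
rewrite -sumEFin; apply: lee_sum => J _.
under eq_integral do rewrite EFinM.
rewrite ge0_integralZl//; last 2 first.
- exact/measurable_EFinP.
- by move=> w _; rewrite lee_fin.
rewrite EFinM; apply: lee_wpmul2l; first by rewrite lee_fin invr_ge0 exprn_ge0.
exact: lower_J.
Qed.

End LocalAverage.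

(** * Moments of the binomial law, written as sums over subsets *)

Section BinomialWeights.
Context {R : realType} {I : finType}.
Variable p : R.

Let a (J : {set I}) := \prod_(k : I) (if k \in J then p else 1 - p).

Lemma sum_binomial_weights : \sum_(J : {set I}) a J = 1.
Proof.
rewrite -(@bigA_distr _ _ 1 _ _ _ (fun=> p) (fun=> 1 - p)).
by rewrite big1// => k _; rewrite /= addrC subrK.
Qed.

Lemma sum_card_binomial_weights :
  \sum_(J : {set I}) #|J|%:R * a J = #|I|%:R * p.
Proof.
transitivity (\sum_(J : {set I}) \sum_(i : I) (i \in J)%:R * a J).
  apply: eq_bigr => J _; rewrite -mulr_suml; congr (_ * _).
  rewrite -sum1_card natr_sum big_mkcond/=; apply: eq_bigr => i _.
  by case: (_ \in _).
rewrite exchange_big/= (eq_bigr (fun=> p)) ?sumr_const ?mulr_natl// => i _.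
(* Putting 0 for [1 - p] in the factor [i] kills, in the expansion, exactly the sets that miss [i],
   while the product itself collapses to [p]. *)
transitivity (\prod_k (p + if k == i then 0 else 1 - p)).
  rewrite bigA_distr; apply: eq_bigr => J _.
  have [iJ|iJ] := boolP (i \in J); last first.
    by rewrite mul0r (bigD1 i)//= (negbTE iJ) eqxx mul0r.
  rewrite mul1r; apply: eq_bigr => k _; case: ifPn => // kJ.
  by case: eqP => // ki; rewrite ki iJ in kJ.
rewrite (bigD1 i)//= eqxx addr0 big1 ?mulr1// => k /negbTE ->.
by rewrite addrC subrK.
Qed.

Hypothesis p01 : 0 < p <= 1.
Hypothesis np_ge : ln 2 <= #|I|%:R * p.

(** With [n = #|I|], one has (1 - p)^n <= exp(- n p) <= exp(- ln 2). *)
Lemma empty_binomial_weight : a finset.set0 <= 2^-1.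
Proof.
rewrite /a (eq_bigr (fun=> 1 - p)) => [|k _]; last by rewrite inE.
rewrite prodr_const; apply: (@le_trans _ _ (expR (- p) ^+ #|I|)).
  apply: lerXn2r; rewrite ?nnegrE ?subr_ge0 ?expR_ge0//; first by case/andP: p01.
  exact: expR_ge1Dx.
rewrite -expRM_natl mulrN -[leRHS]lnK ?posrE ?invr_gt0// ler_expR lnV ?posrE//.
by rewrite lerN2.
Qed.

Variables (t m : R).
Hypothesis mt : m ^+ 2 <= t.

Let e := \sum_(J : {set I}) #|J|%:R ^- 2 *
  (a J * (#|J|%:R * t + (#|J| * #|J|.-1)%:R * m ^+ 2)).

Let a_ge0 J : 0 <= a J.
Proof.
case/andP: p01 => p0 p1; apply: prodr_ge0 => k _.
by case: ifP => _; [exact: ltW|rewrite subr_ge0].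
Qed.

Let sum_a_neq0 : 2^-1 <= \sum_(J : {set I} | J != finset.set0) a J.
Proof.
rewrite -(lerD2l (a finset.set0)) -(bigD1 (P := predT) (F := a) finset.set0)//=.
by rewrite sum_binomial_weights; have := empty_binomial_weight; lra.
Qed.

Let termE (J : {set I}) : J != finset.set0 ->
  #|J|%:R ^- 2 * (a J * (#|J|%:R * t + (#|J| * #|J|.-1)%:R * m ^+ 2)) =
  a J * (#|J|%:R^-1 * t + (1 - #|J|%:R^-1) * m ^+ 2).
Proof.
rewrite -card_gt0; case: #|J| => //= k _.
by rewrite natrM -natr1; field; rewrite natr1.
Qed.

Let eE : e = \sum_(J : {set I} | J != finset.set0)
  a J * (#|J|%:R^-1 * t + (1 - #|J|%:R^-1) * m ^+ 2).
Proof.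
(* The empty set contributes 0, which matches the convention 0/0 = 0 of the estimator. *)
rewrite /e (bigD1 finset.set0)//= [X in X + _ = _](_ : _ = 0); last first.
  by rewrite finset.cards0 !mul0r addr0 !mulr0.
by rewrite add0r; apply: eq_bigr.
Qed.

Let card_inv (J : {set I}) : J != finset.set0 -> 0 < #|J|%:R^-1 :> R /\ #|J|%:R^-1 <= 1 :> R.
Proof.
rewrite -card_gt0 => J0; rewrite invr_gt0 ltr0n; split=> //.
by rewrite invf_le1 ?ltr0n// ler1n.
Qed.

(** As [m ^+ 2 <= t], each convex combination of [t] and [m ^+ 2] in [eE] is at least [m ^+ 2], and
    the nonempty sets have total weight at least 1/2. *)
Lemma bias_lower_bound : m ^+ 2 / 2 <= e.
Proof.
rewrite eE mulrC (le_trans (ler_wpM2r (sqr_ge0 m) sum_a_neq0))//.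
rewrite mulr_suml; apply: ler_sum => J /card_inv [c0 c1].
apply: ler_wpM2l => //; move: mt; nra.
Qed.

Lemma variance_lower_bound : t / (4 * (#|I|%:R * p)) <= e.
Proof.
have t0 : 0 <= t by apply: le_trans mt; exact: sqr_ge0.
set s := #|I|%:R * p.
have s0 : 0 < s by apply: lt_le_trans np_ge; rewrite ln_gt0 ?ltr1n.
(* [1/k >= 2c - c^2 k] for every [c]; this [c] maximizes the resulting bound on
   the expectation of [1/N]. *)
pose c := (2 * s)^-1.
have c0 : 0 < c by rewrite invr_gt0 mulr_gt0.
rewrite (_ : t / (4 * s) = t * (c - c ^+ 2 * s)); last first.
  by rewrite /c; field; rewrite gt_eqF.
apply: (@le_trans _ _ (\sum_(J : {set I} | J != finset.set0)
    a J * (t * (2 * c - c ^+ 2 * #|J|%:R)))); last first.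
  rewrite eE; apply: ler_sum => J J0; apply: ler_wpM2l => //.
  have [x0 x1] := card_inv J0.
  set x := #|J|%:R^-1 in x0 x1 *.
  have -> : #|J|%:R = x^-1 :> R by rewrite invrK.
  apply: (@le_trans _ _ (x * t)); last first.
    by rewrite lerDl mulr_ge0 ?sqr_ge0// subr_ge0.
  rewrite mulrC; apply: ler_wpM2r => //.
  rewrite -subr_ge0 (_ : _ - _ = x * (1 - c / x) ^+ 2).
    by rewrite mulr_ge0 ?sqr_ge0// ltW.
  by field; rewrite gt_eqF.
rewrite (eq_bigr (fun J => t * (2 * c * a J - c ^+ 2 * (#|J|%:R * a J)))); last first.
  by move=> J _; ring.
rewrite -mulr_sumr ler_wpM2l// sumrB -!mulr_sumr.
have -> : \sum_(J : {set I} | J != finset.set0) #|J|%:R * a J = s.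
  rewrite /s -sum_card_binomial_weights [RHS](bigD1 finset.set0)//=.
  by rewrite finset.cards0 mul0r add0r.
(* The weight of the nonempty sets is at least 1/2, which turns [2 * c] into [c]. *)
apply: lerB => //; move: sum_a_neq0; nra.
Qed.

End BinomialWeights.

(** * Volume and diameter of boxes *)

Section Boxes.
Context {R : realType}.

Lemma lebesgue_tuple_set0 d : lebesgue_tuple (set0 : set (d.-tuple R)) = 0%E.
Proof.
elim: d => [|d IHd] /=; first by rewrite diracE in_set0.
rewrite -[RHS](integral0 lebesgue_measure setT); apply: eq_integral => x _.
exact: IHd.
Qed.

(** Free lower corners are allowed because the upper halves of [box h] in each direction are
    measured later. *)
Definition interval_box d (a b : 'I_d -> R) : set (d.-tuple R) :=
  [set x | forall k, a k <= tnth x k <= b k].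

Lemma measurable_interval_box d (a b : 'I_d -> R) :
  measurable (interval_box a b).
Proof.
rewrite (_ : interval_box a b =
    \bigcap_(k in setT) ((fun x => tnth x k) @^-1` `[a k, b k])); last first.
  apply/seteqP; split=> x /= xab; last move=> k.
    by move=> k _; rewrite /= in_itv/=; exact: xab.
  by have := xab k I; rewrite /= in_itv.
apply: fin_bigcap_measurable => // k _.
rewrite -[X in measurable X]setTI; apply: measurable_tnth => //.
Qed.

(** By induction on [d]: a slice is the box of the remaining sides when the first coordinate lies in
    its interval, and is empty otherwise. *)
Lemma lebesgue_tuple_box d (a b : 'I_d -> R) : (forall k, a k <= b k) ->
  lebesgue_tuple (interval_box a b) = (\prod_k (b k - a k))%:E.
Proof.
elim: d a b => [|d IHd] a b ab /=.
  by rewrite big_ord0 diracE mem_set// => -[].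
pose a' k := a (lift ord0 k); pose b' k := b (lift ord0 k).
have slice (x : R) : [set t : d.-tuple R | interval_box a b [tuple of x :: t]] =
    if x \in `[a ord0, b ord0] then interval_box a' b' else set0.
  case: ifPn => xab; apply/seteqP; split=> t /=.
  - by move=> tab k; have := tab (lift ord0 k); rewrite tnthS.
  - move=> tab k; case: (unliftP ord0 k) => [j ->|->]; last first.
      by rewrite tnth0; rewrite in_itv in xab.
    by rewrite tnthS; exact: tab.
  - by move=> /(_ ord0); rewrite tnth0 => xab'; rewrite in_itv/= xab' in xab.
  - by [].
transitivity (\int[lebesgue_measure]_x
    ((\prod_k (b' k - a' k))%:E * (\1_`[a ord0, b ord0] x)%:E))%E.
  apply: eq_integral => x _; rewrite slice indicE mem_setE; case: ifP => _.
    by rewrite IHd ?mule1// => k; exact: ab.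
  by rewrite lebesgue_tuple_set0 mule0.
rewrite ge0_integralZl//; last 2 first.
- by apply/measurable_EFinP; exact: measurable_indic.
- rewrite lee_fin; apply: prodr_ge0 => k _; rewrite subr_ge0; exact: ab.
rewrite integral_indic// setIT.
rewrite [X in (_ * X)%E](lebesgue_measure_itv `[a ord0, b ord0]) /= lte_fin.
rewrite big_ord_recl mulrC EFinM; congr (_ * _)%E.
(* The length of the interval is given by cases; a degenerate side has length 0, which is still
   [b ord0 - a ord0]. *)
case: ltP => // ba; congr EFin; apply/esym/eqP.
by rewrite subr_eq0 eq_le ba ab.
Qed.

Lemma diam_box d (h : 'I_d -> R) : (forall k, 0 <= h k) ->
  0 <= diam (box h) <= \sum_k h k.
Proof.
move=> h0; set E := [set euclidean_dist x z | x in box h & z in box h].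
have E0 : E (euclidean_dist (origin d) (origin d)).
  by exists (origin d) => [k|]; [|exists (origin d) => // k];
    rewrite tnth_mktuple lexx h0.
have Eub : ubound E (\sum_k h k).
  move=> _ [x xh [z zh <-]]; rewrite /euclidean_dist.
  rewrite -(ger0_norm (sumr_ge0 _ (fun k _ => h0 k))) -sqrtr_sqr ler_sqrt ?sqr_ge0//.
  (* The Euclidean norm of the vector of side lengths is at most their sum. *)
  apply: (@le_trans _ _ (\sum_(k < d) h k ^+ 2)).
    apply: ler_sum => k _; rewrite -ler_sqrt ?sqr_ge0// !sqrtr_sqr.
    rewrite (ger0_norm (h0 k)) ler_norml.
    by have /andP[] := xh k; have /andP[] := zh k; lra.
  rewrite expr2 mulr_suml; apply: ler_sum => k _; rewrite expr2 ler_wpM2l//.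
  by rewrite (bigD1 k)//= lerDl sumr_ge0.
apply/andP; split; last by apply: ge_sup => //; exists (euclidean_dist (origin d) (origin d)).
apply: le_trans (ub_le_sup _ E0); first exact: sqrtr_ge0.
by exists (\sum_k h k).
Qed.

End Boxes.

(** * Conditional lower bounds, and the arithmetic of the rate *)

(** Intersecting [A] with the set [G] where [c <= f] makes the bound pointwise. This loses no
    probability, and can only decrease the integral of the nonnegative [Z]. *)
Lemma cond_expectation_ge {d0 d1 : measure_display} {Omega : measurableType d0}
    {T : measurableType d1} {R : realType} (P : probability Omega R)
    (X : Omega -> T) (Z : Omega -> \bar R) (f : T -> \bar R) (c : R) (A : set T) :
  measurable_fun setT X -> measurable_fun setT Z -> (forall w, 0 <= Z w)%E ->
  is_cond_expectation P X Z f -> 0 <= c ->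
  {ae P, forall w, (c%:E <= f (X w))%E} -> measurable A ->
  (c%:E * P (X @^-1` A) <= \int[P]_(w in X @^-1` A) Z w)%E.
Proof.
move=> mX mZ Z0 [_ mf fE] c0 fc mA.
have mpre D : measurable D -> measurable (X @^-1` D).
  by move=> mD; rewrite -[X in measurable X]setTI; exact: mX.
pose G := [set x | (c%:E <= f x)%E].
have mG : measurable G by rewrite -[G]setTI; exact: emeasurable_fun_c_infty.
have GN : P (~` (X @^-1` G)) = 0%E.
  by apply: measure_negligible => //; apply: measurableC; exact: mpre.
have mAG : measurable (A `&` G) by exact: measurableI.
have PAG : (P (X @^-1` A) <= P (X @^-1` (A `&` G)))%E.
  rewrite -[leRHS]adde0 -GN.
  apply: (@le_trans _ _ (P (X @^-1` (A `&` G) `|` ~` (X @^-1` G)))); last first.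
    by apply: measureU2; [exact: mpre|apply: measurableC; exact: mpre].
  apply: le_measure; rewrite ?inE; first exact: mpre.
    by apply: measurableU; [exact: mpre|apply: measurableC; exact: mpre].
  move=> w Aw; have [Gw|Gw] := pselect (G (X w)); [by left|by right].
apply: (@le_trans _ _ (\int[P]_(w in X @^-1` (A `&` G)) Z w)%E); last first.
  apply: ge0_subset_integral => //; [exact: mpre|exact: mpre| |by move=> w []].
  exact: measurable_funTS.
rewrite fE//; apply: (@le_trans _ _ (\int[P]_(w in X @^-1` (A `&` G)) c%:E)%E).
  rewrite integral_cst; last exact: mpre.
  by apply: lee_wpmul2l => //; rewrite lee_fin.
apply: ge0_le_integral => //; first exact: mpre.
- by apply: measurable_funTS; exact: measurableT_comp.
- by move=> w [].
Qed.

Lemma ln2_ge_half {R : realType} : 2^-1 <= ln 2 :> R.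
Proof.
have := @le_ln1Dx R (- 2^-1); rewrite (_ : 1 + - 2^-1 = 2^-1); last by field.
by rewrite lnV ?posrE// lerN2; apply; lra.
Qed.

(** Put r = sqrt(72 e), so that s <= r. Then gamma sigma2 / n <= s^d (72 e) <= r^(d+2), and it
    remains to take the root of order d + 2. *)
Lemma rate_of_risk {R : realType} (d : nat) (n p s gamma sigma2 e : R) :
  0 < n -> 0 < p -> 0 <= s -> 0 <= gamma -> 0 <= sigma2 ->
  gamma <= s ^+ d / p -> s ^+ 2 <= 72 * e -> sigma2 <= 72 * (n * p) * e ->
  (Num.sqrt 72)^-1 * (gamma * sigma2 / n) `^ (d + 2)%:R^-1 <= e `^ 2^-1.
Proof.
move=> n0 p0 s0 g0 sig0 gs se sige.
have e0 : 0 <= e by have := le_trans (sqr_ge0 s) se; rewrite pmulr_rge0.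
rewrite powR12_sqrt// ler_pdivrMl ?sqrtr_gt0// -sqrtrM//.
set r := Num.sqrt _.
have r0 : 0 <= r by exact: sqrtr_ge0.
have r2 : r ^+ 2 = 72 * e by rewrite sqr_sqrtr// mulr_ge0.
have sr : s <= r by rewrite -(ler_pXn2r (ltn0Sn 1)) ?nnegrE// r2.
have d2 : (d + 2)%:R != 0 :> R by rewrite pnatr_eq0 addn2.
rewrite [leRHS](_ : r = (r `^ (d + 2)%:R) `^ (d + 2)%:R^-1); last first.
  by rewrite -powRrM divff// powRr1.
apply: ge0_ler_powR; rewrite ?nnegrE ?invr_ge0 ?powR_ge0//.
  by rewrite mulr_ge0 ?invr_ge0 ?(ltW n0)// mulr_ge0.
rewrite powR_mulrn// exprD r2 ler_pdivrMr//.
apply: (@le_trans _ _ ((s ^+ d / p) * (72 * (n * p) * e))).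
  by apply: ler_pM.
rewrite (_ : _ * _ = s ^+ d * (72 * e) * n); last by field; rewrite gt_eqF.
by rewrite ler_wpM2r ?(ltW n0)// ler_wpM2r ?mulr_ge0// lerXn2r ?nnegrE.
Qed.

(** * Moments of the response over the box, for a uniform design *)

Section UniformDesign.
Context {R : realType} {d : nat} {d0 : measure_display}
  {Omega : measurableType d0}.
Variables (P : probability Omega R) (X : Omega -> d.-tuple R) (Y : Omega -> R) (h : 'I_d -> R).
Hypothesis mX : measurable_fun setT X.
Hypothesis mY : measurable_fun setT Y.
Hypothesis hunif : uniform_on_cube P X.
Hypothesis hh : forall k, 0 < h k <= 1.

Let p := \prod_(k < d) h k.
Let s := \sum_(k < d) h k.
Let U : set Omega := X @^-1` box h.

Let h0 k : 0 < h k. Proof. by case/andP: (hh k). Qed.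

Let mbox : measurable (box h). Proof. exact: measurable_interval_box. Qed.

Let mpre D : measurable D -> measurable (X @^-1` D).
Proof. by move=> mD; rewrite -[X in measurable X]setTI; exact: mX. Qed.

Let mU : measurable U. Proof. exact: mpre. Qed.

Lemma volume_box : lebesgue_tuple (box h) = p%:E.
Proof.
rewrite [box h](_ : _ = interval_box (fun=> 0) h)// lebesgue_tuple_box.
  by under eq_bigr do rewrite subr0.
by move=> k; exact: ltW.
Qed.

Let P_interval_box (a : 'I_d -> R) : (forall k, 0 <= a k <= h k) ->
  P (X @^-1` interval_box a h) = (\prod_k (h k - a k))%:E.
Proof.
move=> ah; rewrite hunif; last exact: measurable_interval_box.
rewrite -lebesgue_tuple_box => [|k]; last by case/andP: (ah k).
congr lebesgue_tuple; apply/seteqP; split=> x /=; first by case.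
move=> xah; split=> // k; have := xah k; have := ah k; have := hh k; lra.
Qed.

Lemma probability_box : P U = p%:E.
Proof.
rewrite /U [box h](_ : _ = interval_box (fun=> 0) h)// P_interval_box.
  by under eq_bigr do rewrite subr0.
by move=> k; rewrite lexx ltW.
Qed.

Let coord_sum_box x : box h x -> 0 <= coord_sum x <= s.
Proof.
move=> hx; apply/andP; split; last by apply: ler_sum => k _; case/andP: (hx k).
by apply: sumr_ge0 => k _; case/andP: (hx k).
Qed.

Let integral_U (f : Omega -> R) :
  (\int[P]_(w in U) (f w)%:E = \int[P]_w (\1_U w * f w)%:E)%E.
Proof.
rewrite integral_mkcond epatch_indic; apply: eq_integral => w _.
by rewrite [in RHS]EFinM muleC.
Qed.

Let mcoord_sum : measurable_fun setT (fun w => coord_sum (X w)).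
Proof.
apply: measurable_sum => k.
exact: (measurableT_comp (measurable_tnth k) mX).
Qed.

(** A Markov-type bound: coordinate [k] is at least [h k / 2] on the upper half [V k] of the box, of
    probability [p / 2]. Summing gives [s / 4], half of the exact mean, which suffices. *)
Lemma integral_coord_sum_box_ge :
  ((p * (s / 4))%:E <= \int[P]_(w in U) (coord_sum (X w))%:E)%E.
Proof.
pose a k j : R := if j == k then h k / 2 else 0.
have ah k j : 0 <= a k j <= h j.
  by rewrite /a; case: eqP => [->|_]; have := h0 k; have := h0 j; lra.
pose V k := X @^-1` interval_box (a k) h.
have mV k : measurable (V k) by apply: mpre; exact: measurable_interval_box.
have PV k : P (V k) = (p / 2)%:E.
  rewrite P_interval_box//; congr EFin.
  rewrite /p (bigD1 k)//= [in RHS](bigD1 k)//= /a eqxx.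
  rewrite (eq_bigr h); first by field.
  by move=> j /negbTE ->; rewrite subr0.
have VU k : V k `<=` U.
  by move=> w Vw j; have := Vw j; have := ah k j; lra.
apply: (@le_trans _ _ (\int[P]_(w in U) \sum_k (h k / 2 * \1_(V k) w)%:E)%E).
  rewrite ge0_integral_sum//; last 2 first.
  - by move=> k; apply/measurable_EFinP; apply: measurable_funM.
  - by move=> k w _; rewrite lee_fin mulr_ge0// divr_ge0// ltW.
  rewrite le_eqVlt; apply/orP; left; apply/eqP.
  rewrite /s mulr_suml mulr_sumr -sumEFin; apply: eq_bigr => k _.
  under eq_integral do rewrite EFinM.
  rewrite ge0_integralZl//; last 2 first.
  - by apply/measurable_EFinP; exact: measurable_indic.
  - by rewrite lee_fin divr_ge0// ltW.
  rewrite integral_indic// setIidl//.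
  rewrite [X in (_ * X)%E](PV k) -EFinM.
  by congr EFin; field.
apply: ge0_le_integral => //.
- by move=> w _; apply: sume_ge0 => k _; rewrite lee_fin mulr_ge0// divr_ge0// ltW.
- apply: emeasurable_sum => k; apply/measurable_EFinP.
  by apply: measurable_funM => //; exact: measurable_indic.
- by apply/measurable_EFinP; exact: measurable_funTS.
move=> w Uw; rewrite sumEFin lee_fin; apply: ler_sum => k _.
rewrite indicE; have [/set_mem Vw|_] := boolP (w \in V k).
  by have := Vw k; rewrite /a eqxx mulr1 => /andP[].
by rewrite mulr0; case/andP: (Uw k).
Qed.

Hypothesis hreg : is_cond_expectation P X (fun w => (Y w)%:E)
  (fun x => (coord_sum x)%:E).

(** If [Y] is nonnegative rather than integrable, its integral over [U] equals that of the
    regression function, which is at most [s] there. *)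
Lemma integrable_box : P.-integrable setT (fun w => (\1_U w * Y w)%:E).
Proof.
have mUY : measurable_fun setT (fun w => (\1_U w * Y w)%:E).
  by apply/measurable_EFinP; apply: measurable_funM => //; exact: measurable_indic.
case: hreg => [[Yint|[_ Y0]] _ YE].
  apply: (le_integrable measurableT mUY _ Yint) => w _ /=.
  by rewrite lee_fin normrM indicE; case: (_ \in _);
    rewrite ?normr1 ?mul1r// normr0 mul0r.
apply/integrableP; split => //.
rewrite (eq_integral (fun w => (\1_U w * Y w)%:E)); last first.
  by move=> w _; rewrite gee0_abs// lee_fin mulr_ge0// -lee_fin.
rewrite -integral_U YE//.
apply: (@le_lt_trans _ _ (\int[P]_(w in U) s%:E)%E).
  apply: ge0_le_integral => //.
  - by move=> w /coord_sum_box /andP[]; rewrite lee_fin.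
  - by apply/measurable_EFinP; exact: measurable_funTS.
  - by move=> w /coord_sum_box /andP[]; rewrite lee_fin.
by rewrite integral_cst// [X in (_ * X)%E]probability_box -EFinM ltry.
Qed.

Let p0 : 0 < p. Proof. exact: prodr_gt0. Qed.

(** The conditional mean of [Y] given that [X] lies in the box. *)
Definition box_mean : R := fine (\int[P]_w (\1_U w * Y w)%:E)%E / p.

Lemma box_meanE : (\int[P]_w (\1_U w * Y w)%:E)%E = (p * box_mean)%:E.
Proof.
rewrite /box_mean mulrC divfK ?gt_eqF// fineK//.
exact: integrable_fin_num integrable_box.
Qed.

Lemma box_mean_ge : s / 4 <= box_mean.
Proof.
rewrite -(ler_pM2l p0) -lee_fin -box_meanE -integral_U.
by case: hreg => _ _ -> //; exact: integral_coord_sum_box_ge.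
Qed.

(** Jensen's inequality on the box, from Y^2 = (Y - m)^2 + (2 m Y - m^2). The second part is
    integrable on the box even if Y^2 is not. *)
Lemma box_second_moment_ge_mean :
  ((p * box_mean ^+ 2)%:E <= \int[P]_w (\1_U w * Y w ^+ 2)%:E)%E.
Proof.
set m := box_mean.
pose f w := \1_U w * (Y w - m) ^+ 2.
have m1U : measurable_fun setT (\1_U : Omega -> R) by exact: measurable_indic.
have mf : measurable_fun setT f.
  by apply: measurable_funM => //; apply: measurable_funX; exact: measurable_funB.
have f0 w : 0 <= f w by rewrite mulr_ge0 ?sqr_ge0.
have i1U : P.-integrable setT (fun w => (\1_U w)%:E).
  exact: integrable_indic.
pose c w := 2 * m * (\1_U w * Y w) - m ^+ 2 * \1_U w.
have fcE w : f w + c w = \1_U w * Y w ^+ 2 by rewrite /f /c; ring.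
have iA := integrableZl measurableT (2 * m) integrable_box.
have iB := integrableZl measurableT (m ^+ 2) i1U.
have cint : P.-integrable setT (EFin \o c) by exact: (integrableB measurableT iA iB).
have c_int : (\int[P]_w (c w)%:E)%E = (p * m ^+ 2)%:E.
  transitivity (\int[P]_w ((2 * m)%:E * (\1_U w * Y w)%:E - (m ^+ 2)%:E * (\1_U w)%:E))%E.
    by [].
  rewrite integralB// !integralZl// ?box_meanE; last exact: integrable_box.
  rewrite integral_indic// setIT [X in (_ - _ * X)%E]probability_box -!EFinM -EFinB; congr EFin.
  by rewrite -/m; ring.
rewrite -c_int; under [leRHS]eq_integral do rewrite -fcE.
apply: le_trans (ge0_integralD_integrable mf f0 cint _); last first.
  by move=> w; rewrite fcE mulr_ge0 ?sqr_ge0.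
by rewrite leeDr//; apply: integral_ge0 => w _; rewrite lee_fin.
Qed.

Variables (v : d.-tuple R -> \bar R) (sigma2 : R).
Hypothesis hv : is_cond_expectation P X
  (fun w => ((Y w - coord_sum (X w)) ^+ 2)%:E) v.
Hypothesis sigma2_ge0 : 0 <= sigma2.
Hypothesis hvar : {ae P, forall w, (sigma2%:E <= v (X w))%E}.

(* [(Y - g(X))^2 <= 2 Y^2 + 2 g(X)^2] is used instead of the exact decomposition
   of the second moment, so that no orthogonality of the noise to [g(X)], nor
   any square integrability, is needed. *)
Lemma box_second_moment_ge_noise :
  ((p * (sigma2 / 2 - s ^+ 2))%:E <= \int[P]_w (\1_U w * Y w ^+ 2)%:E)%E.
Proof.
have mYc : measurable_fun setT (fun w => ((Y w - coord_sum (X w)) ^+ 2)%:E).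
  by apply/measurable_EFinP; apply: measurable_funX; exact: measurable_funB.
have eps0 w : (0 <= ((Y w - coord_sum (X w)) ^+ 2)%:E)%E.
  by rewrite lee_fin sqr_ge0.
have := cond_expectation_ge mX mYc eps0 hv sigma2_ge0 hvar mbox.
rewrite [X in (_ * X)%E]probability_box.
have mY2 : measurable_fun setT (fun w => (Y w ^+ 2)%:E).
  by apply/measurable_EFinP; exact: measurable_funX.
have : (\int[P]_(w in U) ((Y w - coord_sum (X w)) ^+ 2)%:E <=
    2%:E * (\int[P]_(w in U) (Y w ^+ 2)%:E) + (2 * s ^+ 2 * p)%:E)%E.
  apply: (@le_trans _ _ (\int[P]_(w in U) (2%:E * (Y w ^+ 2)%:E + (2 * s ^+ 2)%:E))%E).
    apply: ge0_le_integral => //.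
    - exact: measurable_funTS.
    - apply: measurable_funTS; apply: emeasurable_funD => //.
      exact: emeasurable_funM.
    move=> w /coord_sum_box; rewrite -EFinM -EFinD lee_fin.
    move: (coord_sum _) (Y w) => g z /andP[g0 gs].
    have gs2 : g ^+ 2 <= s ^+ 2 by rewrite lerXn2r ?nnegrE// (le_trans g0).
    by have := sqr_ge0 (z + g); nra.
  rewrite ge0_integralD//; last 3 first.
  - by move=> w _; rewrite mule_ge0// lee_fin ?sqr_ge0.
  - by apply: measurable_funTS; exact: emeasurable_funM.
  - by move=> w _; rewrite lee_fin mulr_ge0// sqr_ge0.
  rewrite ge0_integralZl//; last 2 first.
  - exact: measurable_funTS.
  - by move=> w _; rewrite lee_fin sqr_ge0.
  by rewrite integral_cst// [X in (_ + _ * X)%E]probability_box.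
move=> le2 le1; move: (le_trans le1 le2).
(* An infinite second moment makes the bound trivial, and the value [-oo] contradicts the combined
   inequality. *)
rewrite integral_U; case: (\int[P]_w _)%E => [x| |]//=.
- rewrite -!EFinM -EFinD !lee_fin; lra.
- by rewrite leey.
- by rewrite mulrNy gtr0_sg// mul1e.
Qed.

End UniformDesign.

(** * From the sample to the bound on the risk *)

(** Independence is applied to the indices [Some i] only; the generic pair at [None] serves as the
    common reference law. *)
Lemma independent_sample {d0 d1 : measure_display} {Omega : measurableType d0}
    {T : measurableType d1} {R : realType} (P : probability Omega R)
    (I : finType) (Z : option I -> Omega -> T) :
  mutually_independent P Z -> identically_distributed P Z ->
  forall D : I -> set T, (forall i, measurable (D i)) ->
  P [set w | forall i, D i (Z (Some i) w)] =
  (\prod_i P (Z None @^-1` D i))%E.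
Proof.
move=> indep ident D mD.
pose B o := if o is Some i then D i else setT.
have mB o : measurable (B o) by case: o => [i|]; [exact: mD|exact: measurableT].
have := indep [set Some i | i : I]%SET B mB.
rewrite big_imset/=; last by move=> i j _ _ [].
rewrite (eq_bigr (fun i => P (Z None @^-1` D i))) => [|i _]; last exact: ident.
move=> <-; congr (P _); apply/seteqP; split=> w /= Dw.
  by move=> _ /imsetP[i _ ->]; exact: Dw.
by move=> i; apply: (Dw (Some i)); exact: imset_f.
Qed.

Theorem proposition5 (R : realType) (d : nat) (hd : (1 <= d)%N) :
  exists C : R, 0 < C /\
  forall (n : nat) (hn : (1 <= n)%N)
    (d0 : measure_display) (Omega : measurableType d0)
    (P : probability Omega R)
    (X : {RV P >-> d.-tuple R}) (Y : {RV P >-> R})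
    (Xs : 'I_n -> {RV P >-> d.-tuple R}) (Ys : 'I_n -> {RV P >-> R})
    (hind : mutually_independent P (pairs X Y (fun i => Xs i) (fun i => Ys i)))
    (hid : identically_distributed P
             (pairs X Y (fun i => Xs i) (fun i => Ys i)))
    (hunif : uniform_on_cube P X)
    (hreg : is_cond_expectation P X (fun w => (Y w)%:E)
              (fun x => (coord_sum x)%:E))
    (hnoise : is_cond_expectation P X (fun w => (Y w - coord_sum (X w))%:E)
                (fun=> 0%E))
    (sigma2_min : R) (hsigma : 0 <= sigma2_min)
    (v : d.-tuple R -> \bar R)
    (hv : is_cond_expectation P X
            (fun w => ((Y w - coord_sum (X w)) ^+ 2)%:E) v)
    (hvar : {ae P, forall w, (sigma2_min%:E <= v (X w))%E})
    (V : d.-tuple R -> set (d.-tuple R)) (hV : is_local_map V)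
    (h : 'I_d -> R) (hh : forall k, 0 < h k <= 1)
    (hV0 : V (origin d) = box h)
    (gamma : R) (hgamma : 0 < gamma)
    (hdiam : gamma <= diam (V (origin d)) ^+ d /
                      fine (lebesgue_tuple (V (origin d))))
    (hsize : 2 ^+ (d + 4) * ln 2 <= n%:R * \prod_(k < d) h k),
  (('E_P[fun w => ((local_estimator V (fun i => Xs i) (fun i => Ys i)
                      (origin d) w - coord_sum (origin d)) ^+ 2)%R]) `^ 2^-1 >=
   (C * (gamma * sigma2_min / n%:R) `^ (d + 2)%:R^-1)%:E)%E.
Proof.
(* The bias bound gives s^2 <= 16 m^2 <= 32 e. The variance bound gives t <= 4 n p e, so sigma2 <= 2
   t + 2 s^2 <= 8 n p e + 64 e <= 72 n p e, because n p >= 1. *)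
exists (Num.sqrt 72)^-1; split; first by rewrite invr_gt0 sqrtr_gt0.
move=> n hn d0 Omega P X Y Xs Ys hind hid hunif hreg _ sigma2 sigma0 v hv hvar
  V _ h hh hV0 gamma gamma0 hdiam hsize.
have mX : measurable_fun setT X by exact: measurable_funP.
have mY : measurable_fun setT Y by exact: measurable_funP.
pose W w := (X w, Y w).
pose Z i w := (Xs i w, Ys i w).
have mW : measurable_fun setT W by exact: measurable_fun_pair.
have mZ i : measurable_fun setT (Z i).
  by apply: measurable_fun_pair; exact: measurable_funP.
have indepZ := independent_sample hind hid.
pose y (z : d.-tuple R * R) := z.2.
pose B : set (d.-tuple R * R) := fst @^-1` box h.
have mB : measurable B.
  by rewrite -[B]setTI; apply: measurable_fst => //; exact: measurable_interval_box.
have my : measurable_fun setT y by exact: measurable_snd.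
set p := \prod_(k < d) h k in hsize.
pose s := \sum_(k < d) h k.
have h0 k : 0 < h k by case/andP: (hh k).
have p0 : 0 < p by exact: prodr_gt0.
have p1 : p <= 1.
  by apply: prodr_ile1 => k _; case/andP: (hh k) => /ltW -> ->.
pose m := box_mean P X Y h.
pose t := Num.max (m ^+ 2) (sigma2 / 2 - s ^+ 2).
have mt : m ^+ 2 <= t by rewrite le_max lexx.
have tE : ((p * t)%:E <=
    \int[P]_w (\1_(X @^-1` box h) w * Y w ^+ 2)%:E)%E.
  rewrite /t maxEle; case: ifP => _.
    exact: (box_second_moment_ge_noise mX mY hunif hh hv sigma0 hvar).
  exact: (box_second_moment_ge_mean mX mY hunif hh hreg).
have := local_average_lower_bound mZ mW indepZ mB my
  (probability_box hunif hh) (integrable_box mX mY hunif hh hreg)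
  (box_meanE mX mY hunif hh hreg) (le_trans (sqr_ge0 m) mt) tE.
set e := \sum_(J : {set _}) _.
have ln2 : 2^-1 <= ln 2 :> R by exact: ln2_ge_half.
have pow2 : 2 <= 2 ^+ (d + 4) :> R.
  by rewrite addnS exprS ler_peMr// exprn_ege1// ler1n.
(* From [2 ^+ (d + 4) >= 2] and [ln 2 >= 1/2], the size condition yields both n p >= 1 and n p >= ln
   2. *)
have np : 1 <= n%:R * p by apply: le_trans hsize; nra.
have ln2np : ln 2 <= #|'I_n|%:R * p.
  by rewrite card_ord; apply: le_trans hsize; nra.
have p01 : 0 < p <= 1 by rewrite p0.
have bias := bias_lower_bound p01 ln2np mt.
have variance := variance_lower_bound p01 ln2np mt.
rewrite -/e card_ord in bias variance => risk.
have ms : s / 4 <= m by exact: (box_mean_ge mX mY hunif hh hreg).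
have s0 : 0 <= s by apply: sumr_ge0 => k _; exact: ltW.
have n0 : 0 < n%:R :> R by rewrite ltr0n.
have gamma_le : gamma <= s ^+ d / p.
  apply: le_trans hdiam _; rewrite hV0 volume_box//=.
  apply: ler_wpM2r; first by rewrite invr_ge0 ltW.
  have /andP[diam0 diams] := diam_box (fun k => ltW (h0 k)).
  by rewrite lerXn2r ?nnegrE.
have se : s ^+ 2 <= 32 * e by nra.
have sigmae : sigma2 <= 72 * (n%:R * p) * e.
  have sigmat : sigma2 / 2 - s ^+ 2 <= t by rewrite le_max lexx orbT.
  move: variance; rewrite ler_pdivrMr; last by rewrite mulr_gt0// (lt_le_trans ltr01).
  nra.
have rate := rate_of_risk n0 p0 s0 (ltW gamma0) sigma0 gamma_le _ sigmae.
apply: (@le_trans _ _ ((e `^ 2^-1)%:E)).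
  by rewrite lee_fin; apply: rate; nra.
(* The square roots are compared in the extended reals, as the risk may be [+oo]. *)
rewrite -poweR_EFin; apply: gt0_ler_poweR => //.
- by rewrite in_itv/= leey andbT lee_fin; nra.
- rewrite in_itv/= leey andbT unlock.
  by apply: integral_ge0 => w _; rewrite lee_fin sqr_ge0.
rewrite unlock; apply: (le_trans risk).
rewrite le_eqVlt; apply/orP; left; apply/eqP.
apply: eq_integral => w _; congr (_ ^+ 2)%:E.
(* The regression function vanishes at the origin, so the risk there is the second moment of the
   local average. *)
rewrite /coord_sum [X in _ - X]big1 => [|k _]; last by rewrite tnth_mktuple.
by rewrite subr0 /local_estimator hV0.
Qed.
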